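(* The set of quasiequilibria of a generic (finite horizon, perfect information) extensive-form game is either empty or has positive dimension. That is: fix players $I=\{1,\ldots,N\}$ and a game tree in which at least one node labelled by a player has at least two emanating edges. Then for generic payoffs at the leaves, the complex algebraic set of quasiequilibria of the game is either empty or has positive dimension.
   Context: An extensive-form game with players $I=\{1,\ldots,N\}$ is given by a finite rooted tree $T$ (the game tree, edges directed away from the root) in which each non-leaf node is labelled by an element of $\{0,1,\ldots,N\}$, each leaf $\lambda$ is labelled by a real payoff vector $(u_1(\lambda),\ldots,u_N(\lambda))$, and each edge emanating from a node labelled $0$ (nature) has a positive real weight, the weights at each such node summing to $1$. Let $E(\nu)$ be the set of edges emanating from a node $\nu$, and let $A$ be the set of non-leaf nodes not labelled $0$. At $\nu\in A$ the player labelling $\nu$ chooses an edge of $E(\nu)$; at a node labelled $0$ the edge is random with probability given by its weight; at a leaf $\lambda$ player $i$ receives $u_i(\lambda)$. For each node $\nu$, the subtree of $\nu$ and its descendants is itself an extensive-form game, the subgame at $\nu$. Introduce for each $\nu\in A$ and $e\in E(\nu)$ a complex variable $\sigma(e)$ (the probability of choosing $e$ at $\nu$), subject to $\sum_{e\in E(\nu)}\sigma(e)=1$; eliminating one variable per node leaves $d=\sum_{\nu\in A}(|E(\nu)|-1)$ free variables. In the subgame at $\nu$, a pure strategy $\tilde s_j$ of player $j$ selects one edge at each node of the subtree labelled $j$, and $u_j(\tilde s_j,\tilde\sigma_{-j})=\sum_{\lambda}u_j(\lambda)\Pr[\lambda|\tilde s_j,\tilde\sigma_{-j}]$, the sum being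 over leaves $\lambda$ of the subtree, where $\Pr[\lambda|\tilde s_j,\tilde\sigma_{-j}]$ is the product over edges on the path from $\nu$ to $\lambda$ of: the weight (at nodes labelled $0$), the indicator that $\tilde s_j$ selects the edge (at nodes labelled $j$), or $\sigma(e)$ (at nodes labelled by other players). The quasiequilibria are the complex solutions $\sigma$ of the indifference equations $u_j(\tilde s_j,\tilde\sigma_{-j})=u_j(\tilde t_j,\tilde\sigma_{-j})$, for all players $j$, all subgames, and all pure strategies $\tilde s_j,\tilde t_j$ of $j$ in the subgame (for totally mixed strategy profiles these are equivalent to the indifference equations of the whole game). ''Generic'' refers to the real payoffs $u_i(\lambda)$ at the leaves: outside a proper algebraic subset of the space of payoffs for a fixed tree with labels and weights. *)

(* Defs.v *)
(* Real numbers are an arbitrary [R : realType], complex numbers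
   are [R[i]]. *)
From HB Require Import structures.
From mathcomp Require Import all_boot all_order all_algebra.
From mathcomp Require Import boolp classical_sets reals constructive_ereal ereal.
From mathcomp Require Import complex.
From mathcomp Require mpoly.

Set Implicit Arguments.
Unset Strict Implicit.
Unset Printing Implicit Defensive.

Import Order.TTheory GRing.Theory Num.Theory.

Local Open Scope classical_set_scope.
Local Open Scope ring_scope.
Local Open Scope complex_scope.

Section AffineAlgebraicSets.
Variables (K : fieldType) (I : finType).

(* The coordinates of the affine space [I -> K] are numbered by [enum_val]. *)
Definition poly_eval (p : mpoly.mpoly #|I| K) (x : I -> K) : K :=
  mpoly.meval (fun i : 'I_#|I| => x (enum_val i)) p.

Definition zero_locus (S : set (mpoly.mpoly #|I| K)) : set (I -> K) :=
  [set x | forall p, S p -> poly_eval p x = 0].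

Definition algebraic_set (Z : set (I -> K)) : Prop :=
  exists S, Z = zero_locus S.

Definition irreducible_set (Z : set (I -> K)) : Prop :=
  Z !=set0 /\
  forall Z1 Z2, algebraic_set Z1 -> algebraic_set Z2 ->
    Z `<=` Z1 `|` Z2 -> Z `<=` Z1 \/ Z `<=` Z2.

Definition irreducible_chain (V : set (I -> K)) (k : nat)
    (Z : 'I_k.+1 -> set (I -> K)) : Prop :=
  (forall i, [/\ algebraic_set (Z i), irreducible_set (Z i) & Z i `<=` V]) /\
  (forall i j : 'I_k.+1, (i < j)%N -> Z i `<` Z j).

(* Krull dimension of [V]; the empty set has dimension [-oo]. The field [R]
   only serves to provide the codomain [\bar R]. *)
Definition krull_dim (R : realType) (V : set (I -> K)) : \bar R :=
  ereal_sup [set (k%:R)%:E | k in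
    [set k : nat | exists Z : 'I_k.+1 -> set (I -> K), irreducible_chain V Z]].

Definition generic (P : (I -> K) -> Prop) : Prop :=
  exists B : set (I -> K),
    [/\ algebraic_set B, B <> setT & forall x, ~ B x -> P x].

End AffineAlgebraicSets.

(* A game tree with its labels and weights, but without payoffs. [edge] is a
   finite digraph in which every node is reachable from [root], no edge enters
   [root], and every node has at most one incoming edge. The label [None] is
   nature and [Some j] is player [j]; the values of [label] at leaves, and of
   [weight] away from the edges emanating from nature's nodes, are never
   used. *)
Record game_tree (R : realType) (N : nat) := GameTree {
  node :> finType;
  root : node;
  edge : rel node;
  root_no_parent : forall x, ~~ edge x root;
  parent_unique : forall x y z, edge x z -> edge y z -> x = y;
  root_connected : forall x, connect edge root x;
  label : node -> option 'I_N;
  weight : node -> node -> R;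
  weight_gt0 : forall x y, label x = None -> edge x y -> 0 < weight x y;
  weight_sum : forall x, label x = None -> (exists y, edge x y) ->
    \sum_(y | edge x y) weight x y = 1
}.

Arguments root {R N g}.
Arguments edge {R N g}.
Arguments label {R N g}.
Arguments weight {R N g}.

Section Games.
Variables (R : realType) (N : nat) (G : game_tree R N).
Implicit Types (nu x : G) (j : 'I_N).

Definition is_leaf x : bool := [forall y, ~~ edge x y].

Definition leaf : finType := {x : G | is_leaf x}.

Definition player_node x : bool := ~~ is_leaf x && (label x != None).

(* The edges emanating from nodes labelled by a player: the variables sigma. *)
Definition player_edge : finType :=
  {e : G * G | edge e.1 e.2 && (label e.1 != None)}.

Definition source (e : player_edge) : G := (val e).1.
Definition target (e : player_edge) : G := (val e).2.

Definition payoff := (leaf * 'I_N)%type -> R.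
Definition profile := player_edge -> R[i].

(* A pure strategy of [j] in the subgame at [nu]; the values of [s] elsewhere
   than at the nodes labelled [j] of that subgame are never used. *)
Definition pure_strategy nu j (s : G -> G) : Prop :=
  forall x, connect edge nu x -> ~~ is_leaf x -> label x = Some j ->
    edge x (s x).

(* The edge from [x] to [y] lies on the path from [nu] to [l]. *)
Definition on_path nu (l : leaf) (x y : G) : bool :=
  [&& connect edge nu x, edge x y & connect edge y (val l)].

Definition leaf_prob nu j (s : G -> G) (sigma : profile) (l : leaf) : R[i] :=
  (\prod_(e : G * G | on_path nu l e.1 e.2 && (label e.1 == None))
      weight e.1 e.2)%:C *
  \prod_(e : player_edge | on_path nu l (source e) (target e))
      (if label (source e) == Some j then (s (source e) == target e)%:R
       else sigma e).

Definition expected_payoff (u : payoff) nu j (s : G -> G) (sigma : profile) :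
    R[i] :=
  \sum_(l : leaf | connect edge nu (val l))
    (u (l, j))%:C * leaf_prob nu j s sigma l.

(* The quasiequilibria, with all the coordinates [sigma e] kept: eliminating one
   variable per node by means of the affine equations [sum = 1] identifies
   this set with a subset of the d-dimensional complex affine space. *)
Definition quasiequilibria (u : payoff) : set profile :=
  [set sigma |
    (forall x, player_node x ->
       \sum_(e : player_edge | source e == x) sigma e = 1) /\
    (forall nu j s t, pure_strategy nu j s -> pure_strategy nu j t ->
       expected_payoff u nu j s sigma = expected_payoff u nu j t sigma)].

End Games.

(* Main.v *)
(* For every payoff, a nonempty set of quasiequilibria contains a line.
   Take a topmost player node [x] with at least two children: every player node strictly above it has a single child. The
   variables at [x] occur in no effective indifference equation. Indeed, the
   player labelling [x] ignores them; for another player [j] and a subgame at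
   [nu] containing [x], the leaves below [x] contribute
   [\sum_y Pr(nu -> y) * u_j(y)] over the children [y] of [x], where
   [Pr(nu -> y)] does not depend on the strategy of [j], who has no choice
   above [x], and neither does [u_j(y)], by indifference in the subgame at [y];
   the other leaves do not involve the variables at [x]. Hence the probability
   mass can be moved freely between two edges emanating from [x]. *)
Require Import Defs.
From HB Require Import structures.
From mathcomp Require Import all_boot all_order all_algebra.
From mathcomp Require Import boolp classical_sets reals constructive_ereal ereal.
From mathcomp Require Import complex.
From mathcomp Require Import (canonicals) mpoly.
Import Order.TTheory GRing.Theory Num.Theory.
Local Open Scope classical_set_scope.
Local Open Scope ring_scope.

(** * Paths in a finite digraph *)

Lemma connect_first_edge (T : finType) (e : rel T) (x y : T) :
  connect e x y -> x = y \/ exists2 z, e x z & connect e z y.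
Proof.
case/connectP => -[|z p] /=; first by move=> _ ->; left.
by case/andP=> exz pz ->; right; exists z => //; apply/connectP; exists p.
Qed.

Lemma connect_last_edge (T : finType) (e : rel T) (x y : T) :
  connect e x y -> x = y \/ exists2 z, connect e x z & e z y.
Proof.
case/connectP => p; case/lastP: p => [|p z]; first by move=> _ ->; left.
rewrite rcons_path last_rcons => /andP[pp epz] ->; right.
by exists (last x p) => //; apply/connectP; exists p.
Qed.

Lemma connect_backward (T : finType) (e : rel T) (P : T -> Prop) (x y : T) :
  (forall w z, e w z -> P z -> P w) -> connect e x y -> P y -> P x.
Proof.
move=> back /connectP[p]; elim: p x => [|z p IH] x /=; first by move=> _ ->.
by case/andP=> exz pz /(IH z pz) Pz /Pz; apply: back.
Qed.

(** * The ancestor order of a game tree *)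

Section Trees.
Context {R : realType} {N : nat} {G : game_tree R N}.
Implicit Types x y z nu : G.

(** If [y] reached its parent [x], the nodes reachable from [y] would be closed under taking
    parents. They would then contain the root, which would have a parent. *)
Lemma edge_acyclic x y : edge x y -> ~~ connect edge y x.
Proof.
move=> exy; apply/negP => cyx.
have : connect edge y (Defs.root : G).
  apply: (@connect_backward _ edge (fun z => connect edge y z) Defs.root y).
  - move=> w z ewz /connect_last_edge[yz|[c cyc ecz]].
      by rewrite -yz in ewz; rewrite (parent_unique ewz exy).
    by rewrite (parent_unique ewz ecz).
  - exact: root_connected.
  - exact: connect0.
case/connect_last_edge => [yr|[c _ ecr]].
  by move: exy; rewrite yr (negbTE (root_no_parent x)).
by move: ecr; rewrite (negbTE (root_no_parent c)).
Qed.

Lemma connect_antisym x y : connect edge x y -> connect edge y x -> x = y.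
Proof.
case/connect_first_edge => // -[z exz czy] cyx.
by case/negP: (edge_acyclic _ _ exz); apply: connect_trans cyx.
Qed.

Lemma ancestors_comparable {x y z} :
  connect edge x z -> connect edge y z -> connect edge x y \/ connect edge y x.
Proof.
move=> cxz cyz.
(* Walk from [z] back up to [y]: as parents are unique, each node met is still comparable with
   [x]. *)
apply: (@connect_backward _ edge
  (fun w => connect edge x w \/ connect edge w x) y z) cyz _; last by left.
move=> w v ewv [/connect_last_edge[xv|[c cxc ecv]]|cvx].
- by right; rewrite xv; apply: connect1.
- by left; rewrite (parent_unique ewv ecv).
- by right; apply: connect_trans (connect1 ewv) cvx.
Qed.

Lemma connect_child x y z :
  edge x y -> connect edge z y -> z != y -> connect edge z x.
Proof.
move=> exy /connect_last_edge[->|[c czc ecy]]; first by rewrite eqxx.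
by rewrite (parent_unique exy ecy).
Qed.

Lemma child_below_unique x y z w : edge x y -> edge x z ->
  connect edge y w -> connect edge z w -> y = z.
Proof.
move=> exy exz cyw czw; apply/eqP/negPn/negP => yz.
case: (ancestors_comparable cyw czw) => c.
  by case/negP: (edge_acyclic _ _ exy); apply: connect_child exz c yz.
case/negP: (edge_acyclic _ _ exz); apply: connect_child exy c _.
by rewrite eq_sym.
Qed.

(** * Factoring probabilities at an intermediate node *)

Definition above nu y (a b : G) : bool :=
  [&& connect edge nu a, edge a b & connect edge b y].

(** With [on_path_below], this cuts the path from [nu] to [l] at [y]: an edge belongs to the upper
    part exactly when its head still reaches [y]. *)
Lemma on_path_above nu y (l : leaf G) a b :
  connect edge y (val l) ->
  on_path nu l a b && connect edge b y = above nu y a b.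
Proof.
move=> cyl; rewrite /on_path /above -!andbA; do 2!congr (_ && _).
case cby: (connect edge b y); last by rewrite andbF.
by rewrite (connect_trans cby cyl).
Qed.

Lemma on_path_below nu y (l : leaf G) a b :
  connect edge nu y -> connect edge y (val l) ->
  on_path nu l a b && ~~ connect edge b y = on_path y l a b.
Proof.
move=> cny cyl; apply/idP/idP.
  case/andP=> /and3P[cna eab cbl] ncby; apply/and3P; split=> //.
  case: (ancestors_comparable cyl cbl) => c; last by rewrite c in ncby.
  apply: connect_child eab c _; apply: contraNneq ncby => ->; exact: connect0.
case/and3P=> cya eab cbl; apply/andP; split.
  by apply/and3P; split=> //; apply: connect_trans cya.
apply/negP => cby; case/negP: (edge_acyclic _ _ eab).
exact: connect_trans cya.
Qed.

Definition edge_prob (j : 'I_N) (s : G -> G) (sigma : profile G)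
    (e : player_edge G) : R[i] :=
  if label (source e) == Some j then (s (source e) == target e)%:R
  else sigma e.

(** The analogue of [leaf_prob] for a path that ends at an arbitrary node [y]. *)
Definition reach_prob nu y j s sigma : R[i] :=
  (\prod_(e : G * G | above nu y e.1 e.2 && (label e.1 == None))
      weight e.1 e.2)%:C%C *
  \prod_(e : player_edge G | above nu y (source e) (target e))
      edge_prob j s sigma e.

Lemma leaf_prob_factor nu y j s sigma (l : leaf G) :
  connect edge nu y -> connect edge y (val l) ->
  leaf_prob nu j s sigma l =
    reach_prob nu y j s sigma * leaf_prob y j s sigma l.
Proof.
move=> cny cyl; rewrite /leaf_prob /reach_prob.
rewrite (bigID (fun e : G * G => connect edge e.2 y)) /=.
rewrite [X in _ * X](bigID (fun e : player_edge G =>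
  connect edge (target e) y)) /=.
rewrite rmorphM mulrACA; congr (_%:C%C * _ * (_%:C%C * _)).
- by apply: eq_bigl => e; rewrite andbAC on_path_above.
- by apply: eq_bigl => e; rewrite on_path_above.
- by apply: eq_bigl => e; rewrite andbAC on_path_below.
- by apply: eq_bigl => e; rewrite on_path_below.
Qed.

Lemma leaf_prob_eq nu j s (sigma tau : profile G) (l : leaf G) :
  (forall e, on_path nu l (source e) (target e) ->
     label (source e) != Some j -> sigma e = tau e) ->
  leaf_prob nu j s sigma l = leaf_prob nu j s tau l.
Proof.
move=> st; rewrite /leaf_prob; congr (_ * _); apply: eq_bigr => e pe.
by case: ifPn => // lj; apply: st.
Qed.

(** Covers the cases where the variables at [x] are invisible: [x] outside the subgame, or labelled
    [j]. *)
Lemma expected_payoff_eq u nu j s (sigma tau : profile G) :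
  (forall e, connect edge nu (source e) ->
     label (source e) != Some j -> sigma e = tau e) ->
  expected_payoff u nu j s sigma = expected_payoff u nu j s tau.
Proof.
move=> st; apply: eq_bigr => l _; congr (_ * _).
by apply: leaf_prob_eq => e /and3P[? _ _]; apply: st.
Qed.

Lemma sum_leaves_below x (F : leaf G -> R[i]) : ~~ is_leaf x ->
  \sum_(l : leaf G | connect edge x (val l)) F l =
  \sum_(y | edge x y) \sum_(l : leaf G | connect edge y (val l)) F l.
Proof.
move=> nlx.
(* The child of [x] on the way to [l]; the default [x] is never taken for a leaf below [x]. *)
pose child (l : leaf G) :=
  odflt x [pick y | edge x y && connect edge y (val l)].
have childP (l : leaf G) : connect edge x (val l) ->
    edge x (child l) && connect edge (child l) (val l).
  move=> cxl; rewrite /child; case: pickP => [y //|no].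
  case/connect_first_edge: cxl => [xl|[y exy cyl]].
    by move: nlx; rewrite xl (valP l).
  by move: (no y); rewrite exy cyl.
rewrite (partition_big child (fun y => edge x y)) /=; last first.
  by move=> l /childP/andP[].
apply: eq_bigr => y exy; apply: eq_bigl => l; apply/andP/idP.
  by case=> /childP/andP[_ c] /eqP <-.
move=> cyl; have cxl := connect_trans (connect1 exy) cyl; split=> //.
case/andP: (childP l cxl) => ec cc.
by apply/eqP; apply: child_below_unique ec exy cc cyl.
Qed.

(** Isolates the dependence on the variables at [x]: they can enter only through the factors
    [reach_prob nu y]. *)
Lemma expected_payoff_split u nu x j s sigma :
  connect edge nu x -> ~~ is_leaf x ->
  expected_payoff u nu j s sigma =
  \sum_(l : leaf G | connect edge nu (val l) && ~~ connect edge x (val l))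
      (u (l, j))%:C%C * leaf_prob nu j s sigma l +
  \sum_(y | edge x y)
      reach_prob nu y j s sigma * expected_payoff u y j s sigma.
Proof.
move=> cnx nlx; rewrite /expected_payoff.
rewrite (bigID (fun l : leaf G => connect edge x (val l))) /= addrC.
congr (_ + _); rewrite (eq_bigl (fun l : leaf G => connect edge x (val l))).
  rewrite sum_leaves_below //; apply: eq_bigr => y exy.
  rewrite big_distrr; apply: eq_bigr => l cyl /=.
  rewrite (@leaf_prob_factor nu y) //; first by rewrite mulrCA.
  exact: connect_trans cnx (connect1 exy).
move=> l /=; case cxl: (connect edge x (val l)); last by rewrite andbF.
by rewrite (connect_trans cnx cxl).
Qed.

(** * A topmost choice and its free variables *)

Lemma topmost_choice :
  (exists x : G, label x != None /\ (2 <= #|[set y : G | edge x y]%SET|)%N) ->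
  exists x : G, [/\ label x != None, (2 <= #|[set y : G | edge x y]%SET|)%N &
    forall z a b, connect edge z x -> z != x -> label z != None ->
      edge z a -> edge z b -> a = b].
Proof.
case=> x0 [lx0 cx0].
pose P x := (label x != None) && (2 <= #|[set y : G | edge x y]%SET|)%N.
have Px0 : P x0 by rewrite /P lx0.
(* Maximize the number of descendants: a strict ancestor offering a choice would have strictly more,
   itself among them. *)
case: (@arg_maxnP _ x0 P (fun x => #|connect edge x|) Px0).
move=> x /andP[lx cx] mx; exists x; split=> // z a b czx zx lz ea eb.
apply/eqP/negPn/negP => ab.
have Pz : P z.
  rewrite /P lz /=.
  have sab : ([set a; b] \subset [set y | edge z y])%SET.
    by apply/fintype.subsetP => w; rewrite !inE => /orP[] /eqP ->.
  by rewrite (leq_trans _ (subset_leq_card sab)) // cards2 ab.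
have := mx z Pz; apply/negP; rewrite -ltnNge; apply: proper_card.
apply/properP; split.
  by apply/fintype.subsetP => w; apply: connect_trans.
exists z; first exact: connect0.
apply/negP => cxz.
by rewrite (connect_antisym _ _ czx cxz) eqxx in zx.
Qed.

Lemma indifference_topmost u x (sigma tau : profile G) :
  label x != None -> ~~ is_leaf x ->
  (forall z a b, connect edge z x -> z != x -> label z != None ->
     edge z a -> edge z b -> a = b) ->
  (forall e, source e != x -> sigma e = tau e) ->
  (forall nu j s t, pure_strategy nu j s -> pure_strategy nu j t ->
     expected_payoff u nu j s sigma = expected_payoff u nu j t sigma) ->
  forall nu j s t, pure_strategy nu j s -> pure_strategy nu j t ->
    expected_payoff u nu j s tau = expected_payoff u nu j t tau.
Proof.
move=> lx nlx top st ind nu j s t ps pt.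
have [cnx|ncnx] := boolP (connect edge nu x); last first.
  have same r : expected_payoff u nu j r tau = expected_payoff u nu j r sigma.
    apply: expected_payoff_eq => e ce _; rewrite st //.
    by apply: contraNneq ncnx => <-.
  by rewrite !same; apply: ind.
have [lj|lj] := eqVneq (label x) (Some j).
  have same r : expected_payoff u nu j r tau = expected_payoff u nu j r sigma.
    apply: expected_payoff_eq => e ce le; rewrite st //.
    by apply: contraNneq le => ->; rewrite lj.
  by rewrite !same; apply: ind.
have := ind nu j s t ps pt.
rewrite !(@expected_payoff_split u nu x) //.
have below y r : edge x y ->
    expected_payoff u y j r tau = expected_payoff u y j r sigma.
  move=> exy; apply: expected_payoff_eq => e ce _; rewrite st //.
  by apply: contraNneq (edge_acyclic _ _ exy) => <-.
have aside r : \sum_(l : leaf G | connect edge nu (val l) &&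
      ~~ connect edge x (val l)) (u (l, j))%:C%C * leaf_prob nu j r tau l =
    \sum_(l : leaf G | connect edge nu (val l) &&
      ~~ connect edge x (val l)) (u (l, j))%:C%C * leaf_prob nu j r sigma l.
  apply: eq_bigr => l /andP[_ ncxl]; congr (_ * _).
  apply: leaf_prob_eq => e /and3P[_ ee cel] _; rewrite st //.
  by apply: contraNneq ncxl => <-; apply: connect_trans (connect1 ee) cel.
(* A node of [j] on the path to [y] is not [x], so it lies strictly above [x] and has a single
   child, on which [s] and [t] must agree. *)
have reach y rho : edge x y ->
    reach_prob nu y j s rho = reach_prob nu y j t rho.
  move=> exy; rewrite /reach_prob; congr (_ * _).
  apply: eq_bigr => e /and3P[cne ee cey]; rewrite /edge_prob.
  case: eqP => // le.
  have nx : source e != x by apply: contraNneq lj => <-; apply/eqP.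
  have nle : ~~ is_leaf (source e).
    by apply/forallPn; exists (target e); rewrite negbK.
  have cex : connect edge (source e) x.
    apply: (connect_child _ _ _ exy); first exact: connect_trans (connect1 ee) cey.
    apply/eqP => ey; rewrite ey in ee.
    by case/negP: (edge_acyclic _ _ ee).
  rewrite (top _ _ _ cex nx _ (ps _ cne nle le) (pt _ cne nle le)) //.
  by rewrite le.
(* Indifference at [y] is known for [sigma]; [below] transfers it to [tau]. *)
have children rho : rho = sigma \/ rho = tau ->
    \sum_(y | edge x y) reach_prob nu y j s rho * expected_payoff u y j s rho =
    \sum_(y | edge x y) reach_prob nu y j t rho * expected_payoff u y j t rho.
  move=> rhoE; apply: eq_bigr => y exy; rewrite reach //; congr (_ * _).
  have sub r : pure_strategy nu j r -> pure_strategy y j r.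
    move=> pr z cyz; apply: pr.
    exact: connect_trans (connect_trans cnx (connect1 exy)) cyz.
  have indy := ind y j s t (sub _ ps) (sub _ pt).
  by case: rhoE => -> //; rewrite !below.
(* Cancelling the children's terms in the equation for [sigma] leaves equal sums over the leaves not
   below [x], which are the same for [tau]. *)
rewrite !aside (children sigma) ?(children tau); [|by right|by left].
by move/addIr ->.
Qed.

End Trees.

(** * Lines as irreducible algebraic sets *)

Section AffineLines.
Context {K : numFieldType} {I : finType}.
Implicit Types a d : I -> K.

Definition line a d : set (I -> K) :=
  [set x | exists t : K, x = fun i => a i + t * d i].

Definition coord_poly (i : I) : mpoly.mpoly #|I| K :=
  mpoly.mpolyX K (mpoly.mnm1 (enum_rank i)).

Lemma poly_eval_coord i x : poly_eval (coord_poly i) x = x i.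
Proof. by rewrite /poly_eval /coord_poly mpoly.mevalXU enum_rankK. Qed.

Lemma algebraic_point a : algebraic_set [set a].
Proof.
exists [set p | exists i, p = coord_poly i - mpoly.mpolyC _ (a i)].
apply/seteqP; split=> [x -> p [i ->]|x xS].
  rewrite /poly_eval mpoly.mevalB -/(poly_eval _ a) poly_eval_coord.
  by rewrite mpoly.mevalC subrr.
apply/funext => i; apply/eqP; rewrite -subr_eq0; apply/eqP.
rewrite -[RHS](xS (coord_poly i - mpoly.mpolyC _ (a i))); last by exists i.
rewrite /poly_eval mpoly.mevalB -/(poly_eval _ x) poly_eval_coord.
by rewrite mpoly.mevalC.
Qed.

Lemma algebraic_line a d (i0 : I) : d i0 != 0 -> algebraic_set (line a d).
Proof.
move=> d0.
(* Equations of the line, with the parameter eliminated through coordinate [i0], where the direction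
   is nonzero. *)
pose q i := d i0 *: (coord_poly i - mpoly.mpolyC _ (a i)) -
  d i *: (coord_poly i0 - mpoly.mpolyC _ (a i0)).
have qE i x : poly_eval (q i) x = d i0 * (x i - a i) - d i * (x i0 - a i0).
  rewrite /poly_eval mpoly.mevalB !mpoly.mevalZ !mpoly.mevalB !mpoly.mevalC.
  by rewrite -!/(poly_eval _ x) !poly_eval_coord.
exists [set p | exists i, p = q i].
apply/seteqP; split=> [x [t ->] p [i ->]|x xS].
  by rewrite qE !(addrC (a _)) !addrK mulrCA (mulrCA (d i)) (mulrC (d i)) subrr.
exists ((x i0 - a i0) / d i0); apply/funext => i.
have /eqP := xS _ (ex_intro _ i erefl).
rewrite qE subr_eq0 => /eqP e; rewrite mulrAC (mulrC _ (d i)) -e.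
by rewrite mulrAC divff // mul1r addrC subrK.
Qed.

(** The pullback of [p] along the parametrization of the line. *)
Definition line_poly a d (p : mpoly.mpoly #|I| K) : {poly K} :=
  mpoly.mmap polyC
    (fun k => (a (enum_val k))%:P + 'X * (d (enum_val k))%:P) p.

Lemma horner_line_poly a d p t :
  (line_poly a d p).[t] = poly_eval p (fun i => a i + t * d i).
Proof.
rewrite /line_poly /poly_eval /mpoly.meval /mpoly.mmap horner_sum.
apply: eq_bigr => m _; rewrite hornerM hornerC; congr (_ * _).
rewrite /mpoly.mmap1 horner_prod; apply: eq_bigr => k _.
by rewrite horner_exp !hornerE.
Qed.

Lemma poly_nonroot (p : {poly K}) : p != 0 -> exists t, p.[t] != 0.
Proof.
move=> p0; apply: contrapT => no.
(* In characteristic zero these are [size p] distinct values, more than a nonzero [p] has roots. *)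
pose rs : seq K := [seq n%:R | n <- iota 0 (size p)].
suff : (size rs < size p)%N by rewrite size_map size_iota ltnn.
apply: max_poly_roots => //.
  apply/allP => t _; apply/eqP; apply: contrapT => /eqP pt.
  by apply: no; exists t.
rewrite map_inj_uniq ?iota_uniq // => m n /eqP; rewrite eqr_nat.
exact: eqP.
Qed.

(** If neither closed set contains the line, each has an equation with nonzero pullback. The product
    of the two pullbacks is nonzero, and a parameter where it does not vanish gives a point outside
    both sets. *)
Lemma irreducible_line a d : irreducible_set (line a d).
Proof.
split; first by exists (fun i => a i + 0 * d i); exists 0.
move=> _ _ [S1 ->] [S2 ->] cov; apply: contrapT => /not_orP[n1 n2].
have witness S : ~ (line a d `<=` zero_locus S) ->
    exists2 p, S p & line_poly a d p != 0.
  move=> n; apply: contrapT => no; apply: n => _ [t ->] p Sp.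
  rewrite -horner_line_poly; apply/eqP/negPn/negP => pt; apply: no; exists p => //.
  by apply: contraNneq pt => ->; rewrite horner0.
have [p1 Sp1 z1] := witness _ n1; have [p2 Sp2 z2] := witness _ n2.
have [t] := poly_nonroot _ (mulf_neq0 z1 z2).
rewrite hornerM !horner_line_poly; apply/negP; rewrite negbK mulf_eq0.
have [|c|c] := cov (fun i => a i + t * d i); first by exists t.
  by rewrite (c p1 Sp1) eqxx.
by rewrite (c p2 Sp2) eqxx orbT.
Qed.

Lemma irreducible_point a : irreducible_set [set a].
Proof.
split; first by exists a.
move=> Z1 Z2 _ _ cov.
by case: (cov a erefl) => Za; [left|right] => _ ->.
Qed.

Lemma krull_dim_gt0 (R : realType) a d (i0 : I) (V : set (I -> K)) :
  d i0 != 0 -> line a d `<=` V -> (0 < krull_dim R V)%E.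
Proof.
move=> d0 sub.
(* The chain point inside line has length 1; it is strict because the point at parameter 1 differs
   from [a] in coordinate [i0]. *)
pose Z (i : 'I_2) := if i == ord0 then [set a] else line a d.
have al : line a d a.
  by exists 0; apply/funext => i; rewrite mul0r addr0.
apply: (@lt_le_trans _ _ (1%:R%:E : \bar R)%E); first by rewrite lte_fin ltr01.
apply: ereal_sup_ubound; exists 1%N => //; exists Z; split=> [i|i j ij].
  rewrite /Z; case: ifP => _; split.
  - exact: algebraic_point.
  - exact: irreducible_point.
  - by move=> _ ->; apply: sub.
  - exact: algebraic_line d0.
  - exact: irreducible_line.
  - exact: sub.
have -> : i = ord0 by apply/val_inj; case: i j ij => [[|[]]] // ? [[|[]]].
have -> : j = ord_max by apply/val_inj; case: i j ij => [[|[]]] // ? [[|[]]].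
rewrite /Z eqxx /=; split=> [_ -> //|].
move=> /(_ (fun i => a i + 1 * d i)) c.
have /(congr1 (fun f => f i0))/eqP := c (ex_intro _ 1 erefl).
by rewrite mul1r -subr_eq0 addrC addKr (negbTE d0).
Qed.

End AffineLines.

(** * A line of quasiequilibria *)

Theorem theorem7 (R : realType) (N : nat) (G : game_tree R N)
    (hG : exists x : G, label x != None /\ (2 <= #|[set y : G | edge x y]%SET|)%N) :
  generic (fun u : payoff G =>
    quasiequilibria u = set0 \/ (0 < krull_dim R (quasiequilibria u))%E).
Proof.
(* No payoff is exceptional: the empty set is the zero locus of all polynomials, among them the
   constant 1. *)
exists set0; split.
- exists setT; apply/seteqP; split=> // x /(_ (mpoly.mpolyC _ 1) I).
  by rewrite /poly_eval mpoly.mevalC => /eqP; rewrite oner_eq0.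
- by move/seteqP=> [_ /(_ (fun=> 0) I)].
move=> u _; have [x [lx cx top]] := topmost_choice hG.
have [->|/set0P[sigma [sums ind]]] := eqVneq (quasiequilibria u) set0; [by left|right].
have [y1 [y2 [e1 e2 y12]]] : exists y1 y2, [/\ edge x y1, edge x y2 & y1 != y2].
  by case/card_gt1P: cx => y1 [y2 []]; rewrite !inE => ? ? ?; exists y1, y2.
have h1 : edge (x, y1).1 (x, y1).2 && (label (x, y1).1 != None) by rewrite e1.
have h2 : edge (x, y2).1 (x, y2).2 && (label (x, y2).1 != None) by rewrite e2.
pose f1 : player_edge G := exist _ (x, y1) h1.
pose f2 : player_edge G := exist _ (x, y2) h2.
have f12 : f1 != f2.
  by apply: contraNneq y12 => /(congr1 val) /= [->].
have nlx : ~~ is_leaf x by apply/forallPn; exists y1; rewrite negbK.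
(* Moving along [d] shifts mass from [f2] to [f1], so the sum of the variables at [x] is
   preserved. *)
pose d (e : player_edge G) : R[i] := (e == f1)%:R - (e == f2)%:R.
have d1 : d f1 != 0 by rewrite /d eqxx (negbTE f12) subr0 oner_eq0.
apply: (@krull_dim_gt0 _ _ R sigma d f1 _ d1) => _ [t ->].
have dz e : source e != x -> d e = 0.
  move=> ne; rewrite /d.
  have -> : (e == f1) = false by apply: contraNF ne => /eqP ->.
  have -> : (e == f2) = false by apply: contraNF ne => /eqP ->.
  by rewrite subrr.
split=> [z pz|]; last first.
  apply: (indifference_topmost _ x sigma) => // e ne.
  by rewrite dz // mulr0 addr0.
rewrite big_split /= sums // -big_distrr /=.
suff -> : \sum_(e : player_edge G | source e == z) d e = 0 by rewrite mulr0 addr0.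
have [->|zx] := eqVneq z x; last first.
  by apply: big1 => e /eqP se; apply: dz; rewrite se.
rewrite sumrB.
have single f : source f = x ->
    \sum_(e : player_edge G | source e == x) (e == f)%:R = 1 :> R[i].
  move=> sf; rewrite (bigD1 f) ?sf //= eqxx big1 ?addr0 // => e /andP[_].
  by move/negbTE ->.
by rewrite !single // subrr.
Qed.
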